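(* Let $\Sigma$ be a SISO linear switched system (LSS) with $D\ge2$ modes $Q=\{1,\dots,D\}$, state dimensions $n_1,\dots,n_D$, matrices $(E_q,A_q,B_q,C_q)_{q\in Q}$, coupling matrices $K_{i,j}$ and zero initial state. Let $\Gamma$ and $\Theta$ be finite sets of right and left tuples as in the context, with $\operatorname{card}(\Gamma_q)=\operatorname{card}(\Theta_q)=k_q$ for every $q\in Q$, and let $\mathbb{L}_j,\mathbb{L}_{s,j},V_j,W_j,\Xi_{i,j}$ be the associated Loewner quantities. Assume that $\mathbb{L}_j$ is invertible for $j=1,\dots,D$ and that none of the interpolation points occurring in the tuples of $\Gamma$ and $\Theta$ is an eigenvalue of any of the Loewner pencils $(\mathbb{L}_{s,j},\mathbb{L}_j)$, $j=1,\dots,D$. Then the LSS $\hat\Sigma$ (with state dimensions $k_1,\dots,k_D$ and zero initial state) given by $$\hat E_j=-\mathbb{L}_j,\quad \hat A_j=-\mathbb{L}_{s,j},\quad \hat B_j=V_j,\quad \hat C_j=W_j,\quad \hat K_{i,j}=\Xi_{i,j},\qquad i,j\in\{1,\dots,D\},\ i\neq j,$$ matches the data of $\Sigma$ associated with $\Gamma$ and $\Theta$. If moreover $k_j=n_j$ for $j=1,\dots,D$, then $\hat\Sigma$ is equivalent to $\Sigma$.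
   Context: **LSS with $D$ modes.** $\Sigma$ is given by $E_q,A_q\in\mathbb{R}^{n_q\times n_q}$, $B_q\in\mathbb{R}^{n_q\times1}$, $C_q\in\mathbb{R}^{1\times n_q}$ for $q\in Q=\{1,\dots,D\}$ and coupling matrices $K_{i,j}\in\mathbb{R}^{n_j\times n_i}$ for $i\ne j$ (switching from mode $i$ to mode $j$; coupling of a mode with itself is excluded). The reduced LSS has the same structure, possibly with complex entries. $\Phi_q(s)=(sE_q-A_q)^{-1}$. A number $s$ is an eigenvalue of a pencil $(A,E)$ if $\det(sE-A)=0$. **Generalized transfer functions.** For a word $(q_1,\dots,q_r)\in Q^r$ with consecutive symbols distinct, $$H_{q_1,\dots,q_r}(s_1,\dots,s_r)=C_{q_1}\Phi_{q_1}(s_1)K_{q_2,q_1}\Phi_{q_2}(s_2)\cdots K_{q_r,q_{r-1}}\Phi_{q_r}(s_r)B_{q_r};$$ $\hat H$ denotes the analogous functions of $\hat\Sigma$. **Tuples.** $\Gamma,\Theta\subseteq\bigcup_{r\ge1}Q^r\times\mathbb{C}^r$ are finite sets of tuples $(q_1,\dots,q_r,s_1,\dots,s_r)$ with consecutive modes $q_t\neq q_{t+1}$, such that - for all $r\ge2$: $(q_1,\dots,q_r,\lambda_1,\dots,\lambda_r)\in\Gamma\Rightarrow(q_2,\dots,q_r,\lambda_2,\dots,\lambda_r)\in\Gamma$; - for all $r\ge2$: $(q_1,\dots,q_r,\mu_1,\dots,\mu_r)\in\Theta\Rightarrow(q_1,\dots,q_{r-1},\mu_1,\dots,\mu_{r-1})\in\Theta$.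 It is assumed that every interpolation point $s_t$ occurring in a tuple together with mode $q_t$ is not an eigenvalue of $(A_{q_t},E_{q_t})$. Let $\Gamma_q$ be the set of tuples of $\Gamma$ with $q_1=q$, enumerated as $w_q^{(1)},\dots,w_q^{(k_q)}$, and let $\Theta_q$ be the set of tuples of $\Theta$ whose last mode is $q$, enumerated as $v_q^{(1)},\dots,v_q^{(k_q)}$. **Controllability and observability matrices.** For $w=(q,q_2,\dots,q_r,\lambda_1,\dots,\lambda_r)\in\Gamma_q$ put $$\mathbf r(w)=\Phi_q(\lambda_1)K_{q_2,q}\Phi_{q_2}(\lambda_2)\cdots K_{q_r,q_{r-1}}\Phi_{q_r}(\lambda_r)B_{q_r}\in\mathbb{C}^{n_q\times1},$$ and for $v=(q_1,\dots,q_{r-1},q,\mu_1,\dots,\mu_r)\in\Theta_q$ put $$\mathbf o(v)=C_{q_1}\Phi_{q_1}(\mu_1)K_{q_2,q_1}\Phi_{q_2}(\mu_2)\cdots K_{q,q_{r-1}}\Phi_q(\mu_r)\in\mathbb{C}^{1\times n_q}.$$ $\mathcal{R}_q\in\mathbb{C}^{n_q\times k_q}$ has columns $\mathbf r(w_q^{(1)}),\dots,\mathbf r(w_q^{(k_q)})$, and $\mathcal{O}_q\in\mathbb{C}^{k_q\times n_q}$ has rows $\mathbf o(v_q^{(1)}),\dots,\mathbf o(v_q^{(k_q)})$. **Loewner quantities.** $\mathbb{L}_j=-\mathcal{O}_jE_j\mathcal{R}_j$, $\mathbb{L}_{s,j}=-\mathcal{O}_jA_j\mathcal{R}_j$, $W_j=C_j\mathcal{R}_j$,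 $V_j=\mathcal{O}_jB_j$, $\Xi_{i,j}=\mathcal{O}_jK_{i,j}\mathcal{R}_i$. **Matching the data.** For a tuple $w=(q_1,\dots,q_r,s_1,\dots,s_r)$ write $H[w]=H_{q_1,\dots,q_r}(s_1,\dots,s_r)$; for two tuples $v,w$ let $v\odot w$ be the tuple obtained by concatenating their mode words and concatenating their point tuples. $\hat\Sigma$ matches the data of $\Sigma$ if $H[w]=\hat H[w]$ for all $w\in\Gamma_q$, $q\in Q$; $H[v]=\hat H[v]$ for all $v\in\Theta_q$, $q\in Q$; and $H[v\odot w]=\hat H[v\odot w]$ for all $v\in\Theta_j$, $w\in\Gamma_i$, $i\neq j$. **Equivalence.** Two LSS $\hat\Sigma,\bar\Sigma$ of the same order $(n_1,\dots,n_D)$ are equivalent if there are nonsingular (complex) matrices $Z_j^L,Z_j^R$, $j\in Q$, with $\bar E_j=Z_j^L\hat E_jZ_j^R$, $\bar A_j=Z_j^L\hat A_jZ_j^R$, $\bar B_j=Z_j^L\hat B_j$, $\bar C_j=\hat C_jZ_j^R$ and $\bar K_{i,j}=Z_j^L\hat K_{i,j}Z_i^R$ for $i\neq j$. *)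

(* Defs.v *)
From HB Require Import structures.
From mathcomp Require Import all_boot all_order all_algebra.
From mathcomp Require Import finmap.
From mathcomp Require Import complex reals.

Set Implicit Arguments.
Unset Strict Implicit.
Unset Printing Implicit Defensive.

Import Order.TTheory GRing.Theory Num.Theory.

Local Open Scope fset_scope.
Local Open Scope ring_scope.

(* The modes 1, ..., D are the elements of 'I_D. The matrix lssK i j is the
   coupling used when switching from mode i to mode j. The blocks lssK i i are
   not part of the data: words have distinct consecutive modes, so they never
   occur in a transfer function, and equivalence does not constrain them. The
   initial state is zero and hence is not recorded. *)
Record lss (F : fieldType) (D : nat) (n : 'I_D -> nat) := LSS {
  lssE : forall q, 'M[F]_(n q);
  lssA : forall q, 'M[F]_(n q);
  lssB : forall q, 'cV[F]_(n q);
  lssC : forall q, 'rV[F]_(n q);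
  lssK : forall i j, 'M[F]_(n j, n i) }.

Definition map_lss (F F' : fieldType) (f : F -> F') (D : nat)
    (n : 'I_D -> nat) (S : lss F n) : lss F' n :=
  LSS (fun q => map_mx f (lssE S q)) (fun q => map_mx f (lssA S q))
      (fun q => map_mx f (lssB S q)) (fun q => map_mx f (lssC S q))
      (fun i j => map_mx f (lssK S i j)).

Definition cast_lss (F : fieldType) (D : nat) (k n : 'I_D -> nat)
    (e : forall q, k q = n q) (S : lss F k) : lss F n :=
  LSS (fun q => castmx (e q, e q) (lssE S q))
      (fun q => castmx (e q, e q) (lssA S q))
      (fun q => castmx (e q, erefl 1%N) (lssB S q))
      (fun q => castmx (erefl 1%N, e q) (lssC S q))
      (fun i j => castmx (e j, e i) (lssK S i j)).

Definition pencil_eigenvalue (F : fieldType) (n : nat) (A E : 'M[F]_n) (s : F)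
  : bool := \det (s *: E - A) == 0.

(* A tuple (q_1, ..., q_r, s_1, ..., s_r) is the sequence of pairs
   [:: (q_1, s_1); ...; (q_r, s_r)], so that concatenating the mode words and
   the point tuples of v and w is v ++ w. *)
Definition word (F : fieldType) (D : nat) : choiceType := seq ('I_D * F)%type.

Section Words.
Variables (F : fieldType) (D : nat).
Implicit Types (w : word F D) (G : {fset word F D}) (q : 'I_D).

Definition admissible w : bool :=
  (w != [::]) && sorted (fun x y => x.1 != y.1) w.

Definition first_mode w : option 'I_D := if w is x :: _ then Some x.1 else None.

Definition last_mode w : option 'I_D :=
  if w is x :: u then Some (last x u).1 else None.

Definition right_tuples G : Prop :=
  (forall w, w \in G -> admissible w) /\
  (forall x y u, [:: x, y & u] \in G -> y :: u \in G).

Definition left_tuples G : Prop :=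
  (forall v, v \in G -> admissible v) /\
  (forall u x y, rcons (rcons u x) y \in G -> rcons u x \in G).

Definition right_at G q : {fset word F D} :=
  [fset w in G | first_mode w == Some q].

Definition left_at G q : {fset word F D} :=
  [fset v in G | last_mode v == Some q].

Definition enumerates (G : {fset word F D}) (k : nat)
  (w : k.-tuple (word F D)) : Prop := uniq w /\ w =i G.

End Words.

Section Transfer.
Variables (F : fieldType) (D : nat) (n : 'I_D -> nat) (S : lss F n).

Definition resolvent (q : 'I_D) (s : F) : 'M[F]_(n q) :=
  invmx (s *: lssE S q - lssA S q).

(* K_{q_2,q} Phi_{q_2}(s_2) ... K_{q_r,q_{r-1}} Phi_{q_r}(s_r) B_{q_r},
   for u = [:: (q_2, s_2); ...; (q_r, s_r)] *)
Fixpoint right_chain (q : 'I_D) (u : word F D) : 'cV[F]_(n q) :=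
  if u is (q2, s2) :: u' then
    lssK S q2 q *m (resolvent q2 s2 *m right_chain q2 u')
  else lssB S q.

(* C_{q_1} Phi_{q_1}(s_1) K_{q_2,q_1} ... Phi_{q_{r-1}}(s_{r-1}) K_{q,q_{r-1}},
   for the reversed sequence u = [:: (q_{r-1}, s_{r-1}); ...; (q_1, s_1)] *)
Fixpoint left_chain (q : 'I_D) (u : word F D) : 'rV[F]_(n q) :=
  if u is (q', s') :: u' then
    (left_chain q' u' *m resolvent q' s') *m lssK S q q'
  else lssC S q.

Definition transfer (w : word F D) : F :=
  if w is (q, s) :: u then
    (lssC S q *m (resolvent q s *m right_chain q u)) 0 0
  else 0.

(* r(w), meaningful for words w with first mode q; passing q separately fixes
   the dimension of the vector. *)
Definition rvec (q : 'I_D) (w : word F D) : 'cV[F]_(n q) :=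
  if w is (_, s) :: u then resolvent q s *m right_chain q u else 0.

(* o(v), meaningful for words v with last mode q *)
Definition ovec (q : 'I_D) (v : word F D) : 'rV[F]_(n q) :=
  if rev v is (_, s) :: u then left_chain q u *m resolvent q s else 0.

End Transfer.

Section Loewner.
Variables (F : fieldType) (D : nat) (n k : 'I_D -> nat) (S : lss F n).
Variables (w v : forall q : 'I_D, (k q).-tuple (word F D)).

Definition ctrl_mx (q : 'I_D) : 'M[F]_(n q, k q) :=
  \matrix_(i, m) rvec S q (tnth (w q) m) i 0.

Definition obs_mx (q : 'I_D) : 'M[F]_(k q, n q) :=
  \matrix_(m, i) ovec S q (tnth (v q) m) 0 i.

Definition loewner (j : 'I_D) : 'M[F]_(k j) :=
  - (obs_mx j *m lssE S j *m ctrl_mx j).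

Definition shifted_loewner (j : 'I_D) : 'M[F]_(k j) :=
  - (obs_mx j *m lssA S j *m ctrl_mx j).

Definition loewnerW (j : 'I_D) : 'rV[F]_(k j) := lssC S j *m ctrl_mx j.

Definition loewnerV (j : 'I_D) : 'cV[F]_(k j) := obs_mx j *m lssB S j.

Definition loewnerXi (i j : 'I_D) : 'M[F]_(k j, k i) :=
  obs_mx j *m lssK S i j *m ctrl_mx i.

Definition loewner_lss : lss F k :=
  LSS (fun j => - loewner j) (fun j => - shifted_loewner j)
      loewnerV loewnerW loewnerXi.

End Loewner.

Definition matches_data (F : fieldType) (D : nat) (n k : 'I_D -> nat)
    (Gam The : {fset word F D}) (S : lss F n) (S' : lss F k) : Prop :=
  [/\ forall q w, w \in right_at Gam q -> transfer S w = transfer S' w,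
      forall q v, v \in left_at The q -> transfer S v = transfer S' v
    & forall i j v w, i != j -> v \in left_at The j -> w \in right_at Gam i ->
        transfer S (v ++ w) = transfer S' (v ++ w)].

Definition lss_equivalent (F : fieldType) (D : nat) (n : 'I_D -> nat)
    (S S' : lss F n) : Prop :=
  exists ZL ZR : forall j, 'M[F]_(n j),
    [/\ forall j, ZL j \in unitmx /\ ZR j \in unitmx,
        forall j, lssE S' j = ZL j *m lssE S j *m ZR j /\
                  lssA S' j = ZL j *m lssA S j *m ZR j,
        forall j, lssB S' j = ZL j *m lssB S j /\
                  lssC S' j = lssC S j *m ZR j
      & forall i j, i != j -> lssK S' i j = ZL j *m lssK S i j *m ZR i].

(* Main.v *)
(** If [w] is the [m]-th tuple of [Gam] with first mode [q], then
    [r(w) = R_q e_m] by definition, and multiplying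
    [(s E - A) r(w) = K r(w') (or B)] by [O_q] gives
    [(s Ehat - Ahat) e_m = Khat rhat(w') (or Bhat)], so that inductively
    [rhat(w) = e_m] and [r(w) = R_q rhat(w)]. Dually [o(v) = ohat(v) O_q].
    Each data value is [C r(w)], [o(v) B] or [o(v) K r(w)], and so is preserved.
    When [k = n], invertibility of [O_q E_q R_q] makes [O_q] and [R_q]
    invertible, and their inverses realize the equivalence. *)

Require Import Defs.
From HB Require Import structures.
From mathcomp Require Import all_boot all_order all_algebra.
From mathcomp Require Import finmap.
From mathcomp Require Import complex reals.

Set Implicit Arguments.
Unset Strict Implicit.
Unset Printing Implicit Defensive.

Import Order.TTheory GRing.Theory Num.Theory.

Local Open Scope fset_scope.
Local Open Scope ring_scope.

Lemma mem_right_at (F : fieldType) (D : nat) (G : {fset word F D}) q x :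
  x \in right_at G q -> exists s u, x = (q, s) :: u /\ x \in G.
Proof.
rewrite !inE /= => /andP [xG]; case: x xG => [//|[q' s] u] xG /eqP [eq_q].
by exists s, u; rewrite -eq_q.
Qed.

(** Left tuples are written as reversals so that induction on [u] strips the last letter, matching
    both the recursion of [left_chain] and the closure property of [left_tuples]. *)
Lemma mem_left_at (F : fieldType) (D : nat) (G : {fset word F D}) q x :
  x \in left_at G q -> exists s u, x = rev ((q, s) :: u) /\ x \in G.
Proof.
rewrite !inE /= => /andP [xG]; case/lastP: x xG => [//|u [q' s]] xG /eqP lq.
have {lq} eq_q : q' = q.
  by case: u lq {xG} => [|y u] /= [] //; rewrite last_rcons.
by exists s, (rev u); rewrite rev_cons revK -eq_q.
Qed.

Lemma mem_rev_left_at (F : fieldType) (D : nat) (G : {fset word F D}) q s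
    (u : word F D) :
  rev ((q, s) :: u) \in G -> rev ((q, s) :: u) \in left_at G q.
Proof.
move=> uG; rewrite !inE uG /= rev_cons.
by case: (rev u) => [|y t] //=; rewrite last_rcons.
Qed.

Lemma ovec_rev (F : fieldType) (D : nat) (n : 'I_D -> nat) (S : lss F n) q p s
    (u : word F D) :
  ovec S q (rev ((p, s) :: u)) = left_chain S q u *m resolvent S q s.
Proof. by rewrite /ovec revK. Qed.

(** Cuts a transfer function at the junction of two words: empty [x] gives $o(v)B$, nonempty [x]
    gives $o(v)K r(x)$. The induction moves the last letter of the left word to the front of [x]. *)
Lemma transfer_rev_cat (F : fieldType) (D : nat) (n : 'I_D -> nat)
    (S : lss F n) q s (u x : word F D) :
  transfer S (rev ((q, s) :: u) ++ x) =
  (ovec S q (rev ((q, s) :: u)) *m right_chain S q x) 0 0.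
Proof.
rewrite ovec_rev; elim: u q s x => [|[p t] u IHu] q s x.
  by rewrite /= mulmxA.
by rewrite rev_cons cat_rcons IHu /= !mulmxA.
Qed.

Section LoewnerInterpolation.
Variables (F : fieldType) (D : nat) (n k : 'I_D -> nat) (S : lss F n).
Variables (Gam The : {fset word F D}).
Hypotheses (hGam : right_tuples Gam) (hThe : left_tuples The).
Variables (w v : forall q, (k q).-tuple (word F D)).
Hypotheses (hw : forall q, enumerates (right_at Gam q) (w q))
           (hv : forall q, enumerates (left_at The q) (v q)).

Let S' := loewner_lss S w v.

Hypothesis regS : forall (u : word F D) q s,
  u \in Gam `|` The -> (q, s) \in u -> s *: lssE S q - lssA S q \in unitmx.
Hypothesis regS' : forall (u : word F D) q s,
  u \in Gam `|` The -> (q, s) \in u -> s *: lssE S' q - lssA S' q \in unitmx.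

(** The signs in $\hat E=-L$ and $L=-OER$ cancel, so the reduced pencil is a two-sided projection of
    the original one. *)
Lemma loewner_pencil q s :
  s *: lssE S' q - lssA S' q =
  obs_mx S v q *m (s *: lssE S q - lssA S q) *m ctrl_mx S w q.
Proof.
by rewrite /= !opprK mulmxBr mulmxBl -scalemxAr -scalemxAl.
Qed.

Lemma rvec_ctrl_col q s (u : word F D) : (q, s) :: u \in Gam ->
  exists m, rvec S q ((q, s) :: u) = ctrl_mx S w q *m delta_mx m 0.
Proof.
move=> uG; have : (q, s) :: u \in right_at Gam q by rewrite !inE uG /=.
rewrite -(proj2 (hw q)) => /tnthP [m ->]; exists m.
by rewrite -colE; apply/colP => i; rewrite !mxE.
Qed.

Lemma ovec_obs_row q s (u : word F D) : rev ((q, s) :: u) \in The ->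
  exists m, ovec S q (rev ((q, s) :: u)) = delta_mx 0 m *m obs_mx S v q.
Proof.
move=> /mem_rev_left_at; rewrite -(proj2 (hv q)) => /tnthP [m ->]; exists m.
by rewrite -rowE; apply/rowP => i; rewrite !mxE.
Qed.

Lemma rvec_loewner_step q s (u : word F D) : (q, s) :: u \in Gam ->
  right_chain S' q u = obs_mx S v q *m right_chain S q u ->
  rvec S q ((q, s) :: u) = ctrl_mx S w q *m rvec S' q ((q, s) :: u).
Proof.
move=> uG chainE; have [m rE] := rvec_ctrl_col uG.
have uU : (q, s) :: u \in Gam `|` The by apply/fsetUP; left.
have qs_u : (q, s) \in (q, s) :: u by rewrite mem_head.
rewrite rE; congr (_ *m _); rewrite /rvec chainE.
(* It remains to see that $\hat r(w)$ is the unit vector $e_m$; multiplying by the invertible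
   reduced pencil turns this into $O(sE-A)Re_m = O\cdot$chain, where $Re_m=r(w)$ cancels the
   resolvent. *)
apply: (canRL (mulKmx (regS' uU qs_u))).
by rewrite loewner_pencil -!mulmxA -rE /= mulKVmx // (regS uU qs_u).
Qed.

Lemma rvec_loewner q s (u : word F D) : (q, s) :: u \in Gam ->
  rvec S q ((q, s) :: u) = ctrl_mx S w q *m rvec S' q ((q, s) :: u).
Proof.
elim: u q s => [|[p t] u IHu] q s uG; apply: rvec_loewner_step => //.
(* The suffix is again in [Gam], so $\hat K\hat r(w')=OKR\hat r(w')=OKr(w')$. For empty [u] the
   chain identity is $\hat B=OB$, true by definition. *)
have /IHu /= -> : (p, t) :: u \in Gam by apply: (proj2 hGam) uG.
by rewrite !mulmxA.
Qed.

Lemma ovec_loewner_step q s (u : word F D) : rev ((q, s) :: u) \in The ->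
  left_chain S' q u = left_chain S q u *m ctrl_mx S w q ->
  ovec S q (rev ((q, s) :: u)) = ovec S' q (rev ((q, s) :: u)) *m obs_mx S v q.
Proof.
move=> uT chainE; have [m oE] := ovec_obs_row uT.
have uU : rev ((q, s) :: u) \in Gam `|` The by apply/fsetUP; right.
have qs_u : (q, s) \in rev ((q, s) :: u) by rewrite mem_rev mem_head.
rewrite oE; congr (_ *m _); rewrite ovec_rev chainE.
apply: (canRL (mulmxK (regS' uU qs_u))).
by rewrite loewner_pencil !mulmxA -oE ovec_rev mulmxKV // (regS uU qs_u).
Qed.

Lemma ovec_loewner q s (u : word F D) : rev ((q, s) :: u) \in The ->
  ovec S q (rev ((q, s) :: u)) = ovec S' q (rev ((q, s) :: u)) *m obs_mx S v q.
Proof.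
elim: u q s => [|[p t] u IHu] q s uT; apply: ovec_loewner_step => //.
have /IHu : rev ((p, t) :: u) \in The.
  by move: uT; rewrite !rev_cons; apply: (proj2 hThe).
by rewrite !ovec_rev /= => ->; rewrite !mulmxA.
Qed.

Lemma loewner_matches_data : matches_data Gam The S S'.
Proof.
split.
- move=> q x /mem_right_at [s [u [-> uG]]].
  by have /= -> := rvec_loewner uG; rewrite mulmxA.
- move=> q x /mem_left_at [s [u [-> uT]]].
  (* Appending the empty word exposes the value as $o(v)B$. *)
  rewrite -[rev _]cats0 !transfer_rev_cat /=.
  by rewrite (ovec_loewner uT) /= mulmxA.
- move=> i j x y _ /mem_left_at [s [u [-> uT]]] /mem_right_at [t [z [-> zG]]].
  rewrite !transfer_rev_cat (ovec_loewner uT) /=.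
  by have /= -> := rvec_loewner zG; rewrite /loewnerXi !mulmxA.
Qed.
End LoewnerInterpolation.

Lemma castmx_mul3 (F : fieldType) (m m' n p p' q : nat) (e : m = m')
    (e' : p = p') (A : 'M[F]_(m, n)) (X : 'M[F]_(n, q)) (B : 'M[F]_(q, p)) :
  castmx (e, e') (A *m X *m B) =
  castmx (e, erefl n) A *m X *m castmx (erefl q, e') B.
Proof. by case: _ / e; case: _ / e'. Qed.

(** Once $k=n$ all three factors are square, so a product is invertible only if each factor is. *)
Lemma unitmx_cast_factors (F : fieldType) (k n : nat) (e : k = n)
    (A : 'M[F]_(k, n)) (X : 'M[F]_n) (B : 'M[F]_(n, k)) :
  A *m X *m B \in unitmx ->
  castmx (e, erefl n) A \in unitmx /\ castmx (erefl n, e) B \in unitmx.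
Proof.
case: _ / e X A B => X A B.
by rewrite !castmx_id !unitmx_mul => /andP [/andP [-> _] ->].
Qed.

Lemma loewner_equivalent (F : fieldType) (D : nat) (n k : 'I_D -> nat)
    (S : lss F n) (w v : forall q, (k q).-tuple (word F D))
    (e : forall q, k q = n q) :
  (forall j, loewner S w v j \in unitmx) ->
  lss_equivalent (cast_lss e (loewner_lss S w v)) S.
Proof.
move=> unitL.
pose O j := castmx (e j, erefl (n j)) (obs_mx S v j).
pose C j := castmx (erefl (n j), e j) (ctrl_mx S w j).
have unitOC j : O j \in unitmx /\ C j \in unitmx.
  apply: (@unitmx_cast_factors _ _ _ _ _ (lssE S j)).
  by have := unitL j; rewrite /loewner -scaleN1r unitmxZ ?unitrN1.
(* $O_j^{-1}(O_jXR_i)R_i^{-1}=X$ treats $E$ and $A$ (with $i=j$) and the couplings at once, with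
   $Z^L_j=O_j^{-1}$ and $Z^R_j=R_j^{-1}$. *)
have conjK i j (X : 'M[F]_(n j, n i)) :
    invmx (O j) *m castmx (e j, e i) (obs_mx S v j *m X *m ctrl_mx S w i)
      *m invmx (C i) = X.
  have [[uO _] [_ uC]] := (unitOC j, unitOC i).
  by rewrite castmx_mul3 -!mulmxA mulmxV // mulmx1 mulKmx.
exists (fun j => invmx (O j)), (fun j => invmx (C j)); split.
- by move=> j; rewrite !unitmx_inv.
- by move=> j; rewrite /= !opprK !conjK.
- move=> j; have [uO uC] := unitOC j; split=> /=.
    (* An identity factor pads $OB$, and below $CR$, to the triple product that [castmx_mul3]
       expects. *)
    rewrite -[loewnerV _ _ _]mulmx1 castmx_mul3.
    by rewrite castmx_id mulmx1 mulKmx.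
  rewrite -[loewnerW _ _ _]mul1mx /loewnerW mulmxA castmx_mul3.
  by rewrite castmx_id mul1mx mulmxK.
- by move=> i j _; rewrite /= conjK.
Qed.

Theorem lemma5p1 (R : realType) (D : nat) (hD : (2 <= D)%N)
    (n : 'I_D -> nat) (SigmaR : lss R n)
    (Gam The : {fset word R[i] D})
    (hGam : right_tuples Gam) (hThe : left_tuples The)
    (hpoints : forall (u : word R[i] D) (q : 'I_D) (s : R[i]),
       u \in Gam `|` The -> (q, s) \in u ->
       ~~ pencil_eigenvalue (lssA (map_lss (real_complex R) SigmaR) q)
                            (lssE (map_lss (real_complex R) SigmaR) q) s)
    (k : 'I_D -> nat)
    (hcard : forall q, #|` right_at Gam q| = k q /\ #|` left_at The q| = k q)
    (w v : forall q, (k q).-tuple (word R[i] D))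
    (hw : forall q, enumerates (right_at Gam q) (w q))
    (hv : forall q, enumerates (left_at The q) (v q)) :
  let Sigma := map_lss (real_complex R) SigmaR in
  let Sigmahat := loewner_lss Sigma w v in
  (forall j, loewner Sigma w v j \in unitmx) ->
  (forall (u : word R[i] D) (q : 'I_D) (s : R[i]) (j : 'I_D),
     u \in Gam `|` The -> (q, s) \in u ->
     ~~ pencil_eigenvalue (shifted_loewner Sigma w v j)
                          (loewner Sigma w v j) s) ->
  matches_data Gam The Sigma Sigmahat /\
  (forall hkn : forall j, k j = n j,
     lss_equivalent (cast_lss hkn Sigmahat) Sigma).
Proof.
move=> Sigma Sigmahat unitL regL; split; last first.
  by move=> hkn; apply: loewner_equivalent.
apply: (loewner_matches_data hGam hThe hw hv) => u q s uU qs_u.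
  by rewrite unitmxE unitfE; exact: (hpoints u q s uU qs_u).
(* The pencil of [Sigmahat] is the negative of the Loewner pencil, hence invertible at the same
   points. *)
rewrite /= scalerN -opprD -scaleN1r unitmxZ ?unitrN1 // unitmxE unitfE.
exact: (regL u q s q uU qs_u).
Qed.
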